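(* Assume that the system $\partial_t\mathbf{q}+\nabla\cdot\mathbf{f}(\mathbf{q})=0$ admits the involution $$\frac{d}{dt}\,\mathrm{curl}\,L(\mathbf{q})=0\qquad\text{or}\qquad\frac{d}{dt}\,\mathrm{div}\,L(\mathbf{q})=0,$$ i.e. $L(\nabla\cdot\mathbf{f})=\nabla G$ (respectively $L(\nabla\cdot\mathbf{f})=\mathrm{curl}\,\mathbf{G}$) for a suitable $G$ (respectively $\mathbf{G}$), where $L$ is a linear operator. Let $\mathbf{u}_h(\cdot,t)\in\mathcal{U}_h^N$ be a solution of the semi-discrete CG-DG scheme: for every $T_k\in\mathcal{T}_h$ and all $\phi_i\in\mathcal{U}_h^N$, $$\int_{T_k}\phi_i\,\partial_t\mathbf{u}_h\,d\mathbf{x}+\int_{T_k}\phi_i\,\nabla\cdot\tilde{\mathbf{f}}_h\,d\mathbf{x}=0 ,$$ with discrete flux field $\tilde{\mathbf{f}}_h\in\mathcal{W}_h^{N+1}$. If $L(\nabla\cdot\tilde{\mathbf{f}}_h)=\nabla\tilde{G}_h$ with $\tilde{G}_h\in\mathcal{W}_h^{N+1}$ (respectively $L(\nabla\cdot\tilde{\mathbf{f}}_h)=\mathrm{curl}\,\tilde{\mathbf{G}}_h$ with $\tilde{\mathbf{G}}_h\in\mathcal{W}_h^{N+1}$), then the scheme respects the involution pointwise, that is: (curl case) $\frac{d}{dt}\,\mathrm{curl}\,L(\mathbf{u}_h)=0$ pointwise inside every element, and on every interior face $f$ and for every vector $\boldsymbol{\tau}$ tangential to $f$, $\frac{d}{dt}\big[L(\mathbf{u}_h)\cdot\boldsymbol{\tau}\big]=0$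 pointwise on $f$; (divergence case) $\frac{d}{dt}\,\mathrm{div}\,L(\mathbf{u}_h)=0$ pointwise inside every element, and on every interior face $f$ with unit normal $\mathbf{n}$, $\frac{d}{dt}\big[L(\mathbf{u}_h)\cdot\mathbf{n}\big]=0$ pointwise on $f$.
   Context: $\Omega\subset\mathbb{R}^d$ (with $d=3$ for the vector curl) is a computational domain partitioned by a conforming mesh $\mathcal{T}_h=\bigcup T_k$ of non-overlapping simplices. The system $\partial_t\mathbf{q}+\nabla\cdot\mathbf{f}(\mathbf{q})=0$ is a hyperbolic system of conservation laws with state $\mathbf{q}(\mathbf{x},t)\in\mathbb{R}^n$. $L$ is a constant-coefficient linear map $\mathbb{R}^n\to\mathbb{R}^d$ applied pointwise, selecting a vector field from the state (e.g. for acoustics $\mathbf{q}=(\mathbf{v},p)$, $L(\mathbf{q})=\mathbf{v}$; for Maxwell $\mathbf{q}=(\mathbf{E},\mathbf{B})$, $L(\mathbf{q})=\mathbf{E}$ or $\mathbf{B}$). For an integer $N\ge0$, $\mathcal{U}_h^N$ is the space of discontinuous piecewise polynomials of degree at most $N$ on $\mathcal{T}_h$ and $\mathcal{W}_h^{N+1}$ the Lagrange finite element space of globally continuous piecewise polynomials of degree at most $N+1$ (both used componentwise for scalar, vector and tensor fields). $\nabla$, $\mathrm{curl}$ and $\mathrm{div}$ of discrete fields are taken element by element. The discrete flux field $\tilde{\mathbf{f}}_h\in\mathcal{W}_h^{N+1}$ is the nodal Lagrange interpolant of $\mathbf{f}(\tilde{\mathbf{w}}_h)$, with $\tilde{\mathbf{w}}_h=\mathbf{\Pi}_h\mathbf{u}_h$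 for a projector $\mathbf{\Pi}_h$ from $\mathcal{U}_h^N$ to $\mathcal{W}_h^{N+1}$ (e.g. the $L^2$ projection). An interior face $f$ is the common face (edge in 2D) of two neighbouring elements, and $[\,\cdot\,]$ denotes the jump across $f$, i.e. the difference of the two one-sided traces. *)

(* Defs.v *)
(* MathComp / MathComp-Analysis, over an arbitrary [R : realType].  Points of
   R^d and states in R^n are row vectors ['rV[R]_d], ['rV[R]_n]; a flux tensor
   is an n x d matrix whose i-th row is the flux of the i-th state variable. *)
From HB Require Import structures.
From mathcomp Require Import all_boot all_order all_algebra.
From mathcomp Require Import -(notations) mpoly.
From mathcomp Require Import all_classical all_reals all_analysis.

Set Implicit Arguments.
Unset Strict Implicit.
Unset Printing Implicit Defensive.

Import Order.TTheory GRing.Theory Num.Theory.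
Import numFieldNormedType.Exports.

Local Open Scope classical_set_scope.
Local Open Scope ring_scope.

Section Consing.
Context (R : realType) (d : nat).
Let M := measurableTypeR R.

Definition cons_pt (p : M * d.-tuple M) : d.+1.-tuple M := [tuple of p.1 :: p.2].

Lemma measurable_cons_pt : measurable_fun setT cons_pt.
Proof. exact: measurable_cons. Qed.

Definition uncons_pt (t : d.+1.-tuple M) : M * d.-tuple M :=
  (thead t, [tuple of behead t]).

Lemma measurable_uncons_pt : measurable_fun setT uncons_pt.
Proof.
apply: measurable_fun_pair; last exact: measurable_behead.
exact: measurable_tnth.
Qed.

Lemma cons_ptK : cancel cons_pt uncons_pt.
Proof.
move=> [x t]; rewrite /uncons_pt /cons_pt theadE; congr (_, _).
exact: val_inj.
Qed.

Context (mu : {sigma_finite_measure set (d.-tuple M) -> \bar R}).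

Definition lebesgue_cons : set (d.+1.-tuple M) -> \bar R :=
  pushforward (@lebesgue_measure R \x mu)%E cons_pt.

Lemma lebesgue_cons0 : lebesgue_cons set0 = 0%E.
Proof. by rewrite /lebesgue_cons /pushforward preimage_set0 measure0. Qed.

Lemma lebesgue_cons_ge0 A : (0 <= lebesgue_cons A)%E.
Proof. by rewrite /lebesgue_cons /pushforward measure_ge0. Qed.

Lemma lebesgue_cons_sigma_additive : semi_sigma_additive lebesgue_cons.
Proof.
apply: (@measure_semi_sigma_additive _ _ _
  (pushforward (@lebesgue_measure R \x mu)%E cons_pt)) => //.
exact: measurable_cons_pt.
Qed.

HB.instance Definition _ := isMeasure.Build _ _ _ lebesgue_cons
  lebesgue_cons0 lebesgue_cons_ge0 lebesgue_cons_sigma_additive.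

Lemma lebesgue_cons_sigma_finite : sigma_finite setT lebesgue_cons.
Proof.
have /sigma_finiteP[F [FT ndF Foo]] := sigma_finiteT (@lebesgue_measure R).
have /sigma_finiteP[G [GT ndG Goo]] := sigma_finiteT mu.
exists (fun i => uncons_pt @^-1` (F i `*` G i)).
  rewrite -preimage_bigcup (_ : \bigcup_i _ = setT) ?preimage_setT//.
  rewrite -setXTT FT GT predeqE => -[x y]; split.
    by move=> [n _ [Fnx Gny]]; split; exists n.
  move=> [/= [n _ Fnx] [k _ Gky]]; exists (maxn n k) => //; split.
  - by move: x Fnx; exact/subsetPset/ndF/leq_maxl.
  - by move: y Gky; exact/subsetPset/ndG/leq_maxr.
move=> i; have [mF Fi] := Foo i; have [mG Gi] := Goo i; split.
  by rewrite -[X in measurable X]setTI; apply: measurable_uncons_pt => //;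
    exact: measurableX.
rewrite /lebesgue_cons /pushforward -comp_preimage.
rewrite (_ : uncons_pt \o cons_pt = id); last first.
  by apply/funext => p /=; rewrite cons_ptK.
by rewrite preimage_id product_measure1E// lte_mul_pinfty// ge0_fin_numE.
Qed.

HB.instance Definition _ := Measure_isSigmaFinite.Build _ _ _ lebesgue_cons
  lebesgue_cons_sigma_finite.

End Consing.

(* Lebesgue measure on R^d, as the iterated product of the one-dimensional one.
   It lives on [d.-tuple R] because ['rV[R]_d] carries no sigma-algebra. *)
Fixpoint lebesgue_tuple (R : realType) (d : nat) :
    {sigma_finite_measure set (d.-tuple (measurableTypeR R)) -> \bar R} :=
  if d is d'.+1 then lebesgue_cons (lebesgue_tuple R d')
  else dirac ([tuple] : 0.-tuple (measurableTypeR R)).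

Definition row_of_tuple (R : realType) (d : nat)
  (t : d.-tuple (measurableTypeR R)) : 'rV[R]_d := \row_i tnth t i.

Definition integral_over (R : realType) (d : nat)
    (A : set 'rV[R]_d) (g : 'rV[R]_d -> R) : R :=
  \int[lebesgue_tuple R d]_(t in @row_of_tuple R d @^-1` A) g (row_of_tuple t).

Section Operators.
Context (R : realType).

Definition dot (d : nat) (u v : 'rV[R]_d) : R := \sum_i u 0 i * v 0 i.

Definition partial (d : nat) (i : 'I_d) (g : 'rV[R]_d -> R) (x : 'rV[R]_d) : R :=
  'D_(delta_mx 0 i) g x.

Definition grad (d : nat) (g : 'rV[R]_d -> R) (x : 'rV[R]_d) : 'rV[R]_d :=
  \row_i partial i g x.

Definition div (d : nat) (v : 'rV[R]_d -> 'rV[R]_d) (x : 'rV[R]_d) : R :=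
  \sum_i partial i (fun y => v y 0 i) x.

Definition div_tensor (n d : nat) (F : 'rV[R]_d -> 'M[R]_(n, d)) (x : 'rV[R]_d) :
    'rV[R]_n := \row_i div (fun y => row i (F y)) x.

(* [ordS] is the cyclic successor in {0, 1, 2}. *)
Definition curl (v : 'rV[R]_3 -> 'rV[R]_3) (x : 'rV[R]_3) : 'rV[R]_3 :=
  \row_i (partial (ordS i) (fun y => v y 0 (ordS (ordS i))) x
          - partial (ordS (ordS i)) (fun y => v y 0 (ordS i)) x).

(* In the plane there are two curls: the scalar curl of a vector field, and the
   vector curl of a scalar stream function. *)
Definition scurl2 (v : 'rV[R]_2 -> 'rV[R]_2) (x : 'rV[R]_2) : R :=
  partial 0 (fun y => v y 0 1) x - partial 1 (fun y => v y 0 0) x.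

Definition vcurl2 (g : 'rV[R]_2 -> R) (x : 'rV[R]_2) : 'rV[R]_2 :=
  \row_i (if i == 0 then partial 1 g x else - partial 0 g x).

Fixpoint Ck (d m : nat) (g : 'rV[R]_d -> R) : Prop :=
  if m is m'.+1
  then (forall x, differentiable g x) /\ (forall i, Ck m' (partial i g))
  else continuous g.

Definition smooth (n d : nat) (q : 'rV[R]_d -> 'rV[R]_n) : Prop :=
  forall m i, Ck m (fun x => q x 0 i).

(* [diagonalizable] means over the real field R, so that this is the usual
   requirement of real eigenvalues and a full set of eigenvectors. *)
Definition hyperbolic (n d : nat) (f : 'rV[R]_n -> 'M[R]_(n, d)) : Prop :=
  (forall q, differentiable f q) /\
  (forall (q : 'rV[R]_n) (nu : 'rV[R]_d),
     diagonalizable ('J (fun p => (f p *m nu^T)^T) q)).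

(* The flux identity L(div f(q)) = D G, where D is the gradient or a curl.  The
   potential G may depend on the field q in an arbitrary, not necessarily
   pointwise, way. *)
Definition flux_potential (n d : nat) (V : normedModType R)
    (D : ('rV[R]_d -> V) -> 'rV[R]_d -> 'rV[R]_d)
    (f : 'rV[R]_n -> 'M[R]_(n, d)) (L : 'rV[R]_n -> 'rV[R]_d) : Prop :=
  forall q : 'rV[R]_d -> 'rV[R]_n, smooth q ->
  exists G : 'rV[R]_d -> V, (forall x, differentiable G x) /\
    (forall x, L (div_tensor (fun y => f (q y)) x) = D G x).

(* Convex hull of the points [v i], [i \in S]; it is empty if [S] is. *)
Definition hull (d m : nat) (v : 'I_m -> 'rV[R]_d) (S : {set 'I_m}) :
    set 'rV[R]_d :=
  [set x | exists a : 'I_m -> R,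
     [/\ forall i, 0 <= a i, forall i, i \notin S -> a i = 0,
         \sum_i a i = 1 & x = \sum_i a i *: v i]].

(* Indices of the points of [v] that also occur in [w]. *)
Definition shared (d m : nat) (v w : 'I_m -> 'rV[R]_d) : {set 'I_m} :=
  [set i | v i \in codom w]%SET.

(* [Omega] may be the open domain or its closure. *)
Record simplicial_mesh (d : nat) (Omega : set 'rV[R]_d) := SimplicialMesh {
  elt : finType;
  vtx : elt -> 'I_d.+1 -> 'rV[R]_d;
  mesh_nondegenerate : forall k,
    \matrix_(i < d) (vtx k (lift ord0 i) - vtx k ord0) \in unitmx;
  mesh_cover : \bigcup_k hull (vtx k) [set: 'I_d.+1]%SET = closure Omega;
  mesh_nonoverlapping : forall k l, k != l ->
    interior (hull (vtx k) [set: 'I_d.+1]%SET) `&`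
    interior (hull (vtx l) [set: 'I_d.+1]%SET) = set0;
  mesh_conforming : forall k l, k != l ->
    hull (vtx k) [set: 'I_d.+1]%SET `&` hull (vtx l) [set: 'I_d.+1]%SET
    = hull (vtx k) (shared (vtx k) (vtx l)) }.

Definition element (d : nat) (Omega : set 'rV[R]_d) (T : simplicial_mesh Omega)
  (k : elt T) : set 'rV[R]_d := hull (vtx k) [set: 'I_d.+1]%SET.

Definition face (d : nat) (Omega : set 'rV[R]_d) (T : simplicial_mesh Omega)
  (k l : elt T) : set 'rV[R]_d := element k `&` element l.

(* Two elements are neighbours when they have exactly d common vertices; by
   conformity [face k l] is then the (d-1)-simplex spanned by these. *)
Definition neighbours (d : nat) (Omega : set 'rV[R]_d)
    (T : simplicial_mesh Omega) (k l : elt T) : bool :=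
  #|shared (vtx k) (vtx l)| == d.

(* For convex [F] these vectors form the direction space of the affine hull
   of [F]. *)
Definition tangential (d : nat) (F : set 'rV[R]_d) (tau : 'rV[R]_d) : Prop :=
  exists (c : R) (x y : 'rV[R]_d), [/\ F x, F y & tau = c *: (x - y)].

Definition unit_normal (d : nat) (F : set 'rV[R]_d) (nu : 'rV[R]_d) : Prop :=
  dot nu nu = 1 /\ (forall tau, tangential F tau -> dot nu tau = 0).

Definition polynomial_le (d m : nat) (g : 'rV[R]_d -> R) : Prop :=
  exists p : mpoly d R,
    (mmeasure mdeg p <= m.+1)%N /\
    (forall x, g x = meval (fun i => x 0 i) p).

Section Spaces.
Context (d : nat) (Omega : set 'rV[R]_d) (T : simplicial_mesh Omega).

(* A discrete field has one function per element.  In the spaces below it is a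
   polynomial on the whole of R^d, determined by its values on the element;
   evaluating it at a face point gives the one-sided trace, and differentiating
   it the element-by-element derivative. *)
Definition broken (V : Type) := elt T -> 'rV[R]_d -> V.

Definition dg_space (m : nat) (v : broken R) : Prop :=
  forall k, polynomial_le m (v k).

Definition cg_space (m : nat) (v : broken R) : Prop :=
  dg_space m v /\
  exists g : 'rV[R]_d -> R, {within closure Omega, continuous g} /\
    (forall k x, element k x -> v k x = g x).

Definition componentwise (p q : nat) (space : broken R -> Prop)
    (v : broken 'M[R]_(p, q)) : Prop :=
  forall i j, space (fun k x => v k x i j).

Definition projector (n N : nat) (P : broken 'rV[R]_n -> broken 'rV[R]_n) :
    Prop :=
  [/\ forall v, componentwise (dg_space N) v ->
        componentwise (cg_space N.+1) (P v),
      forall (a : R) v w, componentwise (dg_space N) v ->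
        componentwise (dg_space N) w ->
        forall k x, P (fun l y => a *: v l y + w l y) k x
                    = a *: P v k x + P w k x
    & forall v, componentwise (dg_space N) v ->
        componentwise (cg_space N.+1) v -> P v = v].

(* Interpolation nodes for degree m: unisolvent in each element, and matching
   across elements. *)
Definition lagrange_nodes (m : nat) (X : elt T -> seq 'rV[R]_d) : Prop :=
  [/\ forall k x, x \in X k -> element k x,
      forall k l x, x \in X k -> element l x -> x \in X l
    & forall k (y : 'rV[R]_d -> R), exists! p : 'rV[R]_d -> R,
        polynomial_le m p /\ (forall x, x \in X k -> p x = y x)].

Definition nodal_interpolant (p q m : nat) (X : elt T -> seq 'rV[R]_d)
    (w wh : broken 'M[R]_(p, q)) : Prop :=
  componentwise (cg_space m) wh /\
  (forall k x, x \in X k -> wh k x = w k x).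

Record cgdg_scheme (n N : nat) := CGDG {
  flux : 'rV[R]_n -> 'M[R]_(n, d);
  flux_hyperbolic : hyperbolic flux;
  nodes : elt T -> seq 'rV[R]_d;
  nodes_lagrange : lagrange_nodes N.+1 nodes;
  proj : broken 'rV[R]_n -> broken 'rV[R]_n;
  proj_projector : projector N proj }.

(* [u] is the discrete solution and [ft] the discrete flux field, both at the
   times in [I]. *)
Definition cgdg_solution (n N : nat) (S : cgdg_scheme n N) (I : set R)
    (u : R -> broken 'rV[R]_n) (ft : R -> broken 'M[R]_(n, d)) : Prop :=
  [/\ forall t, I t -> componentwise (dg_space N) (u t),
      forall t, I t -> forall k x, element k x ->
        forall i, derivable (fun s => u s k x 0 i) t 1,
      forall t, I t -> nodal_interpolant N.+1 (nodes S)
        (fun k x => flux S (proj S (u t) k x)) (ft t)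
    & forall t, I t -> forall k (phi : broken R), dg_space N phi -> forall i,
        integral_over (element k)
          (fun x => phi k x * 'D_1 (fun s => u s k x 0 i) t)
        + integral_over (element k)
          (fun x => phi k x * div_tensor (ft t k) x 0 i) = 0].

Definition jump (k l : elt T) (g : broken R) (x : 'rV[R]_d) : R :=
  g k x - g l x.

Definition constant_inside (V : normedModType R)
    (D : ('rV[R]_d -> 'rV[R]_d) -> 'rV[R]_d -> V) (I : set R)
    (v : R -> broken 'rV[R]_d) : Prop :=
  forall t k x, I t -> interior (element k) x ->
    is_derive t 1 (fun s => D (v s k) x) 0.

Definition constant_tangential_jumps (I : set R)
    (v : R -> broken 'rV[R]_d) : Prop :=
  forall t k l tau x, I t -> neighbours k l ->
    tangential (face k l) tau -> face k l x ->
    is_derive t 1 (fun s => jump k l (fun m y => dot (v s m y) tau) x) 0.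

Definition constant_normal_jumps (I : set R)
    (v : R -> broken 'rV[R]_d) : Prop :=
  forall t k l nu x, I t -> neighbours k l ->
    unit_normal (face k l) nu -> face k l x ->
    is_derive t 1 (fun s => jump k l (fun m y => dot (v s m y) nu) x) 0.

End Spaces.
End Operators.

(* Main.v *)
Require Import Defs.
From HB Require Import structures.
From mathcomp Require Import all_boot all_order all_algebra.
From mathcomp Require Import -(notations) mpoly.
From mathcomp Require Import all_classical all_reals all_analysis.
From mathcomp Require Import measurable_realfun ring.

Set Implicit Arguments.
Unset Strict Implicit.
Unset Printing Implicit Defensive.

Import Order.TTheory GRing.Theory Num.Theory.
Import numFieldNormedType.Exports.
Local Open Scope classical_set_scope.
Local Open Scope ring_scope.

(** The weak equation holds cell by cell, and inside one cell both terms are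
polynomials of degree at most N.  For [div f_h] this is clear: it is the
divergence of a field of degree at most N + 1.  For the time derivative of
[u_h] it is the statement that the polynomials of degree at most N form a
finite dimensional, hence closed, space: the values at finitely many unisolvent
points of the cell determine the coefficients, so differentiability in time at
the points of the cell gives differentiability of the coefficients
([polynomial_time_derivative]).  The residual [d/dt u_h + div f_h] is therefore
an admissible test function.  Testing with it shows that the integral of its
square over the cell vanishes, and so does the residual, since a simplex has
nonempty interior and a polynomial that vanishes on an open set is zero
([simplex_integral_sqr_eq0]).  Thus the scheme holds pointwise,
[d/dt u_h = - div f_h] ([time_derivative_flux]), and
[d/dt L(u_h) = - grad G_h] or [- curl G_h] as polynomials ([scheme_evolves]).

Inside a cell the involution is now the identity [curl grad = 0] or
[div curl = 0], that is, the symmetry of second derivatives.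

On a face shared by the cells k and l the jump of [L(u_h)] changes at the rate
[- grad h], or [- curl h], with [h = G_k - G_l].  Continuity of [G_h] across
the face means that the polynomial [h] vanishes on the face.  The face is
convex, so [h] vanishes along the segments that start from a given point of the
face, and all tangential derivatives of [h] are zero there
([tangential_derivative_eq0]).  This is the curl case.  In the divergence case
each component of [h] has a gradient orthogonal to the face, which spans a
hyperplane because the two cells have d common vertices, so this gradient is
parallel to the normal ([normal_direction]).  Then [n . curl h] has the shape
[n . (n x c)] for some vector [c], or in the plane is a multiple of the product
of [n] with [n] turned by a right angle, and vanishes. *)

(** * Polynomial functions on R^d *)

Local Notation msize p := (mmeasure mdeg p).

Definition peval {R : realType} {d : nat} (p : mpoly d R) (x : 'rV[R]_d) : R :=
  meval (fun i => x 0 i) p.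

Section PolynomialFunctions.
Context {R : realType} {d : nat}.
Implicit Types (p q : mpoly d R) (x y w : 'rV[R]_d) (g : 'rV[R]_d -> R).

Definition pvar (i : 'I_d) : mpoly d R := mpolyX R (mnm1 i).

Lemma pevalD p q x : peval (p + q) x = peval p x + peval q x.
Proof. exact: mevalD. Qed.

Lemma pevalB p q x : peval (p - q) x = peval p x - peval q x.
Proof. exact: mevalB. Qed.

Lemma pevalN p x : peval (- p) x = - peval p x.
Proof. exact: mevalN. Qed.

Lemma pevalM p q x : peval (p * q) x = peval p x * peval q x.
Proof. exact: mevalM. Qed.

Lemma pevalZ c p x : peval (c *: p) x = c * peval p x.
Proof. exact: mevalZ. Qed.

Lemma pevalC c x : peval (mpolyC d c) x = c.
Proof. exact: mevalC. Qed.

Lemma peval_var i x : peval (pvar i) x = x 0 i.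
Proof. exact: mevalXU. Qed.

Lemma peval_sum (I : Type) (r : seq I) (P : pred I) (F : I -> mpoly d R) x :
  peval (\sum_(i <- r | P i) F i) x = \sum_(i <- r | P i) peval (F i) x.
Proof. by rewrite /peval raddf_sum. Qed.

Lemma mpoly_ring_ind (P : mpoly d R -> Prop) :
  (forall c, P (mpolyC d c)) -> (forall i, P (pvar i)) ->
  (forall p q, P p -> P q -> P (p + q)) ->
  (forall p q, P p -> P q -> P (p * q)) -> forall p, P p.
Proof.
move=> PC PX PD PM p; rewrite [p]mpolyE.
apply: big_ind => [||m _]; [by rewrite -mpolyC0|exact: PD|].
rewrite -mul_mpolyC; apply: (PM) => //; rewrite mpolyXE_id.
apply: big_ind => [||i _]; [by rewrite -mpolyC1|exact: PM|].
elim: (m i) => [|k IH]; first by rewrite expr0 -mpolyC1.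
by rewrite exprS; exact: PM (PX i) IH.
Qed.

(** Reduces questions about polynomials in d variables to univariate ones: the
    second clause is the chain rule for the restriction to a line. *)
Lemma line_restriction p x w : exists q : {poly R}, forall s,
  q.[s] = peval p (x + s *: w) /\
  q^`().[s] = \sum_i w 0 i * peval (mderiv i p) (x + s *: w).
Proof.
elim/mpoly_ring_ind: p => [c|j|p q [P HP] [Q HQ]|p q [P HP] [Q HQ]].
- exists c%:P => s; rewrite hornerC derivC hornerC pevalC; split=> //.
  by rewrite big1// => i _; rewrite mderivC /peval meval0 mulr0.
- exists ((x 0 j)%:P + w 0 j *: 'X) => s; split.
    by rewrite !hornerE peval_var !mxE mulrC.
  rewrite derivD derivC derivZ derivX add0r hornerZ hornerC mulr1.
  rewrite (bigD1 j)//= big1 ?addr0 => [|i ij].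
    rewrite mderivX mnm1E eqxx scale1r -{1}[mnm1 j]add0m addmK.
    by rewrite mpolyX0 /peval meval1 mulr1.
  by rewrite mderivX mnm1E eq_sym (negbTE ij) scale0r /peval meval0 mulr0.
- exists (P + Q) => s; have [HP1 HP2] := HP s; have [HQ1 HQ2] := HQ s.
  rewrite derivD !hornerD HP1 HP2 HQ1 HQ2 pevalD; split=> //.
  rewrite -big_split; apply: eq_bigr => i _ /=.
  by rewrite mderivD pevalD mulrDr.
- exists (P * Q) => s; have [HP1 HP2] := HP s; have [HQ1 HQ2] := HQ s.
  rewrite derivM hornerD !hornerM HP1 HP2 HQ1 HQ2 pevalM; split=> //.
  rewrite mulr_suml mulr_sumr -big_split; apply: eq_bigr => i _ /=.
  by rewrite mderivM pevalD !pevalM; ring.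
Qed.

Lemma derive_along_line g x w : 'D_w g x = 'D_1 (fun s : R => g (x + s *: w)) 0.
Proof.
rewrite /derive.
have -> // : (fun h : R => h^-1 *: ((g \o shift x) (h *: w) - g x)) =
  (fun h : R => h^-1 *: (((fun s => g (x + s *: w)) \o shift 0) (h *: 1)
    - g (x + 0 *: w))).
apply/funext => h /=.
by rewrite addr0 [h%:A]mulr1 scale0r addr0 [x + _]addrC.
Qed.

Lemma partial_peval i p x : partial i (peval p) x = peval (mderiv i p) x.
Proof.
rewrite /partial derive_along_line.
have [q Hq] := line_restriction p x (delta_mx 0 i).
have -> : (fun s : R => peval p (x + s *: delta_mx 0 i)) = horner q.
  by apply/funext => s; have [-> _] := Hq s.
rewrite -derive1E -derivE; have [_ ->] := Hq 0.
rewrite scale0r addr0 (bigD1 i)//= big1 ?addr0 => [|j ji].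
  by rewrite mxE !eqxx mul1r.
by rewrite mxE eqxx (negbTE ji) mul0r.
Qed.

Lemma poly_zero_interval (q : {poly R}) (e : R) : 0 < e ->
  (forall s, 0 <= s <= e -> q.[s] = 0) -> q = 0.
Proof.
move=> e0 q0; apply/eqP/negPn/negP => qn0.
have := @max_poly_roots _ q [seq e / k.+1%:R | k <- iota 0 (size q)] qn0.
rewrite size_map size_iota ltnn => H; apply: (notF (H _ _)).
  apply/allP => _ /mapP[k _ ->]; rewrite rootE q0//.
  by rewrite divr_ge0 ?(ltW e0)//= ler_pdivrMr// ler_peMr ?(ltW e0)// ler1n.
rewrite map_inj_uniq ?iota_uniq// => a b.
move/(mulfI (lt0r_neq0 e0))/invr_inj/eqP.
by rewrite eqr_nat eqSS => /eqP.
Qed.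

(** On the line from [x] to any [y] the polynomial has infinitely many zeros. *)
Lemma peval_eq0_nbhs p x : (\forall y \near x, peval p y = 0) ->
  forall y, peval p y = 0.
Proof.
move=> px y; have [q Hq] := line_restriction p x (y - x).
suff q0 : q = 0.
  have [] := Hq 1; rewrite q0 horner0 scale1r => + _.
  by rewrite addrC subrK => <-.
have : \forall s \near (0 : R), peval p (x + s *: (y - x)) = 0.
  have : (fun s : R => x + s *: (y - x)) @ (0 : R) --> x.
    rewrite [X in _ --> X](_ : x = x + (0 : R) *: (y - x)); last first.
      by rewrite scale0r addr0.
    by apply: cvgD; [exact: cvg_cst|apply: cvgZr_tmp; exact: cvg_id].
  by move=> c; exact: c _ px.
move=> /nbhs_ballP[e /= e0 He].
apply: (@poly_zero_interval _ (e / 2)); first by rewrite divr_gt0.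
move=> s /andP[s0 se]; have [-> _] := Hq s; apply: He.
rewrite /ball/= sub0r normrN ger0_norm// (le_lt_trans se)//.
by rewrite gtr_pMr// invf_lt1 ?ltr1n.
Qed.

Lemma peval_mderiv_eq0 i p : (forall x, peval p x = 0) ->
  forall x, peval (mderiv i p) x = 0.
Proof.
move=> p0 x; rewrite -partial_peval.
have -> : peval p = cst 0 by apply/funext.
by rewrite /partial derive_cst.
Qed.

Lemma peval_at0 p : peval p 0 = mcoeff mnm0 p.
Proof.
elim/mpoly_ring_ind: p => [c|j|p q HP HQ|p q HP HQ].
- by rewrite pevalC mcoeffC eqxx mulr1.
- by rewrite peval_var mxE mcoeffX -mdeg_eq0 mdeg1.
- by rewrite pevalD mcoeffD HP HQ.
- by rewrite pevalM HP HQ (mcoeff0_is_multiplicative d R).1.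
Qed.

(** The coefficient of a monomial is, up to a factorial, the value at 0 of the
    corresponding iterated derivative. *)
Lemma peval_eq0 p : (forall x, peval p x = 0) -> p = 0.
Proof.
move=> p0; apply/mpolyP => m; rewrite mcoeff0.
have pm0 x : peval (mderivm m p) x = 0.
  rewrite mderivm_foldr; elim: (flatten _) x => [|i s IH] //= x.
  exact: peval_mderiv_eq0.
move: (pm0 0); rewrite peval_at0 mcoeff_mderivm addm0.
rewrite (eq_bigr (fun i => (m i)`!%N)) => [|i _]; last by rewrite ffactnn.
move=> /eqP; rewrite mulrn_eq0 => /orP[|/eqP//].
by rewrite gtn_eqF// prodn_gt0// => i; exact: fact_gt0.
Qed.

Lemma peval_inj p q : peval p =1 peval q -> p = q.
Proof.
by move=> pq; apply/subr0_eq/peval_eq0 => x; rewrite pevalB pq subrr.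
Qed.

Lemma msize_leP p k :
  (msize p <= k)%N <-> (forall m, (k <= mdeg m)%N -> mcoeff m p = 0).
Proof.
split=> [pk m km|pk].
  by apply/eqP; rewrite mcoeff_eq0; apply: msize_mdeg_ge; exact: leq_trans km.
rewrite msizeE; apply/bigmax_leqP_seq => m mp _; rewrite ltnNge.
by apply: contraTN mp => /pk /eqP; rewrite mcoeff_eq0.
Qed.

Lemma msize_mderiv i p k : (msize p <= k.+1)%N -> (msize (mderiv i p) <= k)%N.
Proof.
move=> /msize_leP pk; apply/msize_leP => m km.
by rewrite mcoeff_mderiv pk ?mul0rn// mdegD mdeg1 addn1.
Qed.

Lemma continuous_peval p : continuous (peval p).
Proof.
move=> x; elim/mpoly_ring_ind: p => [c|j|p q HP HQ|p q HP HQ].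
- rewrite (_ : peval _ = cst c); first exact: cst_continuous.
  by apply/funext => y; rewrite pevalC.
- rewrite (_ : peval _ = fun y => y 0 j); first exact: coord_continuous.
  by apply/funext => y; rewrite peval_var.
- rewrite (_ : peval _ = peval p \+ peval q); first exact: continuousD.
  by apply/funext => y; rewrite pevalD.
- rewrite (_ : peval _ = peval p \* peval q); first exact: continuousM.
  by apply/funext => y; rewrite pevalM.
Qed.

End PolynomialFunctions.

(** * Simplices *)

Definition affinely_independent {R : realType} {d : nat}
    (v : 'I_d.+1 -> 'rV[R]_d) : bool :=
  \matrix_(i < d) (v (lift ord0 i) - v ord0) \in unitmx.

Section Simplex.
Context {R : realType} {d : nat}.
Implicit Type v : 'I_d.+1 -> 'rV[R]_d.

(** A nondegenerate simplex is cut out by finitely many affine inequalities, all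
    strict at the barycentre: this makes it measurable and gives it interior. *)
Lemma barycentric_coordinates v :
  affinely_independent v ->
  exists lam : 'I_d.+1 -> mpoly d R,
  (forall x, hull v [set: 'I_d.+1]%SET x <-> forall i, 0 <= peval (lam i) x) /\
  (exists c, forall i, 0 < peval (lam i) c).
Proof.
rewrite /affinely_independent; set A := (\matrix_(i < d) _) => nd.
pose b x := (x - v ord0) *m invmx A.
pose mu (i : 'I_d) : mpoly d R :=
  \sum_j invmx A j i *: (pvar j - mpolyC d (v ord0 0 j)).
have muE i x : peval (mu i) x = b x 0 i.
  rewrite peval_sum mxE; apply: eq_bigr => j _.
  by rewrite pevalZ pevalB peval_var pevalC !mxE mulrC.
pose lam (i : 'I_d.+1) := if unlift ord0 i is Some j then mu j else
  mpolyC d 1 - \sum_j mu j.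
have lam0 x : peval (lam ord0) x = 1 - \sum_j b x 0 j.
  rewrite /lam unlift_none pevalB pevalC peval_sum; congr (_ - _).
  by apply: eq_bigr => j _; rewrite muE.
have lamS j x : peval (lam (lift ord0 j)) x = b x 0 j.
  by rewrite /lam liftK muE.
(* comb and lamcomb: [lam] inverts the parametrization by weights of sum 1 *)
have comb (a : 'I_d.+1 -> R) : \sum_i a i = 1 ->
    \sum_i a i *: v i = v ord0 + (\row_j a (lift ord0 j)) *m A.
  rewrite !big_ord_recl => a1.
  have -> : a ord0 = 1 - \sum_(j < d) a (lift ord0 j) by rewrite -a1 addrK.
  rewrite scalerBl scale1r -addrA; congr (_ + _).
  rewrite mulmx_sum_row scaler_suml addrC -sumrB; apply: eq_bigr => j _.
  by rewrite rowK mxE scalerBr.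
have sum1 x : \sum_i peval (lam i) x = 1.
  rewrite big_ord_recl lam0.
  by rewrite (eq_bigr _ (fun j _ => lamS j x)) subrK.
have combx x : \sum_i peval (lam i) x *: v i = x.
  rewrite (comb (fun i => peval (lam i) x)) //.
  rewrite (_ : \row_j _ = b x); last by apply/rowP => j; rewrite mxE lamS.
  by rewrite /b mulmxKV// addrC subrK.
have lamcomb (a : 'I_d.+1 -> R) i : \sum_i a i = 1 ->
    peval (lam i) (\sum_i a i *: v i) = a i.
  move=> a1; have bE : b (\sum_i a i *: v i) = \row_j a (lift ord0 j).
    by rewrite /b comb// addrC addKr mulmxK.
  have [j ->|->] := unliftP ord0 i; first by rewrite lamS bE mxE.
  rewrite lam0 bE -a1 big_ord_recl; under [X in _ - X]eq_bigr do rewrite mxE.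
  by rewrite addrK.
exists lam; split.
  move=> x; split=> [[a [a0 _ a1 ->]] i|lx]; first by rewrite lamcomb.
  exists (fun i => peval (lam i) x); split => // i.
  by rewrite finset.in_setT.
exists (\sum_i d.+1%:R^-1 *: v i) => i.
rewrite (lamcomb (fun=> d.+1%:R^-1)) ?invr_gt0 ?ltr0n//.
by rewrite sumr_const card_ord -[LHS]mulr_natr mulVf ?pnatr_eq0.
Qed.

Lemma simplex_interior_nonempty v :
  affinely_independent v ->
  exists c, interior (hull v [set: 'I_d.+1]%SET) c.
Proof.
move=> /barycentric_coordinates[lam [lamP [c lamc]]].
exists c; rewrite /interior.
suff : \forall x \near c, forall i, 0 <= peval (lam i) x.
  by apply: filterS => x /lamP.
have lam_near i : \forall x \near c, 0 <= peval (lam i) x.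
  have : peval (lam i) @ c --> peval (lam i) c by exact: continuous_peval.
  by move=> /cvgr_ge; apply.
exact: (filter_forall _ lam_near).
Qed.

End Simplex.

(** * Integrals of polynomials over a simplex *)

Section TupleMeasure.
Context {R : realType}.
Local Notation M := (measurableTypeR R).

(** The preimage of a ball of the sup norm under the identification of tuples
    with row vectors. *)
Definition box {d : nat} (a : d.-tuple M) (e : R) : set (d.-tuple M) :=
  [set t | forall i, ball (tnth a i : R) e (tnth t i : R)].

Lemma measurable_box d (a : d.-tuple M) e : measurable (box a e).
Proof.
rewrite (_ : box a e = \bigcap_(i in [set: 'I_d])
    ((fun t : d.-tuple M => tnth t i) @^-1` ball (tnth a i : R) e)); last first.
  by apply/seteqP; split => t /= H i; [move=> _; exact: H|exact: (H i)].
apply: fin_bigcap_measurable; first exact: finite_finset.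
move=> i _; rewrite -[X in measurable X]setTI.
exact: measurable_tnth (measurable_ball _ _).
Qed.

(** Bounds the measure of a simplex from above and that of an open set from
    below. *)
Lemma lebesgue_tuple_box d (a : d.-tuple M) e : 0 <= e ->
  lebesgue_tuple R d (box a e) = ((e *+ 2) ^+ d)%:E.
Proof.
move=> e0; elim: d a => [|d IH] a.
  by rewrite /= diracE expr0 mem_set//= => -[].
pose a' : d.-tuple M := [tuple of behead a].
have aS i : tnth a (lift ord0 i) = tnth a' i.
  by rewrite !(tnth_nth (0 : R)) nth_behead.
rewrite /= /lebesgue_cons /pushforward.
rewrite (_ : _ @^-1` _ = ball (thead a : R) e `*` box a' e); last first.
  apply/seteqP; split => -[x t] /= H.
    split; first by have := H ord0; rewrite /thead.
    move=> i; have := H (lift ord0 i).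
    by rewrite aS tnthS.
  case: H => Hx Ht i; have [j ->|->] := unliftP ord0 i => //.
  by rewrite aS tnthS; exact: Ht.
rewrite product_measure1E; [|exact: measurable_ball|exact: measurable_box].
rewrite IH exprS EFinM; congr (_ * _)%E.
exact: lebesgue_measure_ball.
Qed.

Lemma measurable_peval d (p : mpoly d R) :
  measurable_fun [set: d.-tuple M] (fun t => peval p (row_of_tuple t)).
Proof.
elim/(@mpoly_ring_ind R d): p => [c|j|p q HP HQ|p q HP HQ].
- by under eq_fun do rewrite pevalC; exact: measurable_cst.
- under eq_fun do rewrite peval_var mxE; exact: measurable_tnth.
- by under eq_fun do rewrite pevalD; exact: measurable_funD.
- by under eq_fun do rewrite pevalM; exact: measurable_funM.
Qed.

Lemma peval_bounded d (p : mpoly d R) (B : R) : exists C,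
  forall x : 'rV[R]_d, (forall i, `|x 0 i| <= B) -> `|peval p x| <= C.
Proof.
elim/(@mpoly_ring_ind R d): p => [c|j|p q [C HC] [D HD]|p q [C HC] [D HD]].
- by exists `|c| => x _; rewrite pevalC.
- by exists B => x Hx; rewrite peval_var.
- exists (C + D) => x Hx; rewrite pevalD (le_trans (ler_normD _ _))//.
  by rewrite lerD ?HC ?HD.
- exists (C * D) => x Hx; rewrite pevalM normrM.
  by rewrite ler_pM ?HC ?HD.
Qed.

End TupleMeasure.

Section SimplexIntegral.
Context {R : realType} {d : nat} (v : 'I_d.+1 -> 'rV[R]_d).
Context (nondeg : affinely_independent v).
Local Notation M := (measurableTypeR R).
Let K := hull v [set: 'I_d.+1]%SET.
Let KM : set (d.-tuple M) := @row_of_tuple R d @^-1` K.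
Let mu := lebesgue_tuple R d.

Lemma measurable_simplex : measurable KM.
Proof.
have [lam [lamP _]] := barycentric_coordinates nondeg.
rewrite (_ : KM = \bigcap_(i in [set: 'I_d.+1])
    ((fun t : d.-tuple M => peval (lam i) (row_of_tuple t)) @^-1` `[0, +oo[)).
  apply: fin_bigcap_measurable; first exact: finite_finset.
  move=> i _; rewrite -[X in measurable X]setTI.
  exact: measurable_peval.
apply/seteqP; split => t /= H.
  by move=> i _ /=; rewrite in_itv/= andbT; move/lamP: H; exact.
by apply/lamP => i; have := H i I; rewrite /= in_itv/= andbT.
Qed.

Lemma simplex_bounded : exists B, forall x, K x -> forall i, `|x 0 i| <= B.
Proof.
exists (\sum_i \sum_j `|v j 0 i|) => _ [a [a0 _ a1 ->]] i.
rewrite (bigD1 i)//= ler_wpDr ?sumr_ge0// => [*|]; first by rewrite sumr_ge0.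
rewrite summxE (le_trans (ler_norm_sum _ _ _))// ler_sum// => j _.
rewrite mxE normrM ger0_norm// ler_piMl//.
by rewrite -a1 (bigD1 j)//= ler_wpDr ?sumr_ge0.
Qed.

Lemma simplex_measure_lty : (mu KM < +oo)%E.
Proof.
have [B HB] := simplex_bounded.
pose z : d.-tuple M := [tuple (0 : R) | i < d].
have H : KM `<=` box z (`|B| + 1).
  move=> t /= Kt i; rewrite tnth_mktuple /ball/= sub0r normrN.
  have := HB _ Kt i; rewrite mxE => /le_lt_trans; apply.
  by rewrite ltr_pwDr// ler_norm.
have : (mu KM <= mu (box z (`|B| + 1)))%E.
  apply: le_measure => //; rewrite inE; first exact: measurable_simplex.
  exact: measurable_box.
move=> /le_lt_trans; apply.
by rewrite /mu lebesgue_tuple_box ?ltry// addr_ge0.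
Qed.

Lemma simplex_integrable p :
  mu.-integrable KM (EFin \o (fun t => peval p (row_of_tuple t))).
Proof.
apply: measurable_bounded_integrable.
- exact: measurable_simplex.
- exact: simplex_measure_lty.
- apply: measurable_funTS; exact: measurable_peval.
- have [B HB] := simplex_bounded; have [C HC] := peval_bounded p B.
  exists C; split; first exact: num_real.
  by move=> y Cy t /= Kt; rewrite (le_trans _ (ltW Cy))// HC// => i; exact: HB.
Qed.

Lemma simplex_integralD p q :
  integral_over K (peval p) + integral_over K (peval q) =
  integral_over K (peval (p + q)).
Proof.
rewrite /integral_over -RintegralD; last 3 first.
- exact: measurable_simplex.
- exact: simplex_integrable.
- exact: simplex_integrable.
by apply: eq_Rintegral => t _; rewrite pevalD.
Qed.

(** A vanishing integral only gives that [r] is zero almost everywhere; a point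
    of the interior where [r] is nonzero would have a box of positive measure
    around it on which [r] is nonzero. *)
Lemma simplex_integral_sqr_eq0 r :
  integral_over K (peval (r * r)) = 0 -> forall x, peval r x = 0.
Proof.
move=> Ir; have mK := measurable_simplex.
pose f (t : d.-tuple M) := (peval (r * r) (row_of_tuple t))%:E.
have mf : measurable_fun KM f.
  by case/integrableP: (simplex_integrable (r * r)).
have If0 : (\int[mu]_(t in KM) `|f t|)%E = 0%E.
  have f0 t : (0 <= f t)%E by rewrite lee_fin pevalM sqr_ge0.
  under eq_integral do rewrite gee0_abs//.
  have fin : (\int[mu]_(t in KM) f t)%E \is a fin_num.
    by apply: integrable_fin_num => //; exact: simplex_integrable.
  by rewrite -(fineK fin); congr EFin.
have [Z [mZ Z0 ZP]] := (ae_eq_integral_abs mu mK mf).1 If0.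
have r0 x : interior K x -> peval r x = 0.
  move=> Kx; apply/eqP/negPn/negP => rx.
  have : \forall y \near x, K y /\ peval r y != 0.
    apply: filterI => //.
    have : peval r @ x --> peval r x by exact: continuous_peval.
    by move/cvgr_neq0; apply.
  move=> /nbhs_ballP[e /= e0 He].
  pose a : d.-tuple M := [tuple x 0 i | i < d].
  have aZ : box a e `<=` Z.
    move=> t ta; apply: ZP => /= H.
    have [|Kt] := He (row_of_tuple t).
      by split=> // i j; rewrite ord1 mxE; have := ta j; rewrite tnth_mktuple.
    move=> /eqP; apply; have := H Kt; rewrite /f /= pevalM => -[].
    by move=> /eqP; rewrite mulf_eq0 orbb => /eqP.
  have : (mu (box a e) <= mu Z)%E.
    by apply: le_measure => //; rewrite inE//; exact: measurable_box.
  rewrite Z0 /mu (lebesgue_tuple_box _ (ltW e0)) leNgt lte_fin.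
  by rewrite exprn_gt0// pmulrn_lgt0.
have [c Kc] := simplex_interior_nonempty nondeg.
apply: (@peval_eq0_nbhs R d r c).
have : nbhs c (interior K).
  by apply: open_nbhs_nbhs; split => //; exact: open_interior.
by apply: filterS => y /r0.
Qed.

End SimplexIntegral.

(** * Time-dependent polynomials *)

Section Unisolvence.
Context {R : realType} {d : nat}.

(** The nodes of the scheme supply points of the cell at which the values of a
    polynomial determine it linearly. *)
Lemma lagrange_basis (Omega : set 'rV[R]_d) (T : simplicial_mesh Omega) m
    (X : elt T -> seq 'rV[R]_d) (k : elt T) : lagrange_nodes m X ->
  exists (s : seq 'rV[R]_d) (ell : 'rV[R]_d -> mpoly d R),
    (forall a, a \in s -> element k a) /\
    forall g : 'rV[R]_d -> R, polynomial_le m g ->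
      forall x, g x = \sum_(a <- s) peval (ell a) x * g a.
Proof.
move=> [Xk _ uni].
have [ell ellP] : exists ell : 'rV[R]_d -> mpoly d R, forall a,
    (msize (ell a) <= m.+1)%N /\
    forall x, x \in X k -> peval (ell a) x = (x == a)%:R.
  suff /choice[f fP] : forall a, exists p : mpoly d R, (msize p <= m.+1)%N /\
      forall x, x \in X k -> peval p x = (x == a)%:R by exists f.
  move=> a.
  have [p [[[P [mP pP]] px] _]] := uni k (fun x => (x == a)%:R).
  by exists P; split => // x /px <-; rewrite pP.
exists (undup (X k)), ell; split => [a|g gm x]; first by rewrite mem_undup => /Xk.
have [p [_ puniq]] := uni k g.
have -> : g = p by rewrite (puniq g).
have sumE : p = fun y => \sum_(a <- undup (X k)) peval (ell a) y * g a.
  apply: puniq; split.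
    exists (\sum_(a <- undup (X k)) g a *: ell a); split.
      apply/msize_leP => m' km'.
      rewrite raddf_sum big1// => a _ /=; rewrite mcoeffZ.
      by have [/msize_leP -> //] := ellP a; rewrite mulr0.
    move=> y; rewrite -/(peval _ y) peval_sum.
    by under [RHS]eq_bigr do rewrite pevalZ mulrC.
  move=> y Xy; rewrite (bigD1_seq y) ?mem_undup ?undup_uniq//=.
  have [_ ->//] := ellP y; rewrite eqxx mul1r big1 ?addr0// => a ay.
  by have [_ ->//] := ellP a; rewrite eq_sym (negbTE ay) mul0r.
by rewrite [LHS](congr1 (@^~ x) sumE) (puniq g).
Qed.

Lemma is_derive_lincomb (J : eqType) (s : seq J) (c : J -> R)
    (F : J -> R -> R) (dF : J -> R) (t : R) :
  (forall j, j \in s -> is_derive t 1 (F j) (dF j)) ->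
  is_derive t 1 (fun r => \sum_(j <- s) c j * F j r) (\sum_(j <- s) c j * dF j).
Proof.
elim: s => [|j s IH] FdF.
  rewrite big_nil (_ : (fun=> _) = cst 0); first exact: is_derive_cst.
  by apply/funext => r; rewrite big_nil.
rewrite big_cons (_ : (fun=> _) = (fun r => c j *: F j r) \+
    (fun r => \sum_(j <- s) c j * F j r)); last first.
  by apply/funext => r; rewrite big_cons.
apply: is_deriveD; last by apply: IH => i si; apply: FdF; rewrite inE si orbT.
by apply: is_deriveZ; apply: FdF; rewrite mem_head.
Qed.

(** Differentiability in time at the interpolation points is enough, because the
    coefficients are linear in the values there.  The interpolation may be exact
    in a higher degree [m]; that [Q] has degree at most [N] then comes from
    differentiating the coefficients of higher degree, which are zero. *)
Lemma polynomial_time_derivative (m N : nat) (s : seq 'rV[R]_d)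
    (ell : 'rV[R]_d -> mpoly d R) (I : set R) (g : R -> 'rV[R]_d -> R) (t : R) :
  (forall g : 'rV[R]_d -> R, polynomial_le m g ->
      forall x, g x = \sum_(a <- s) peval (ell a) x * g a) ->
  (N <= m)%N -> open I -> I t ->
  (forall r, I r -> polynomial_le N (g r)) ->
  (forall a, a \in s -> derivable (g^~ a) t 1) ->
  exists Q : mpoly d R, [/\ (msize Q <= N.+1)%N,
    forall x, is_derive t 1 (g^~ x) (peval Q x) &
    forall j x, is_derive t 1 (fun r => partial j (g r) x)
      (peval (mderiv j Q) x)].
Proof.
move=> interp Nm oI It gN dg.
have [P PP] : exists P : R -> mpoly d R, forall r, I r ->
    (msize (P r) <= N.+1)%N /\ g r = peval (P r).
  suff /choice[f fP] : forall r, exists p : mpoly d R, I r ->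
      (msize p <= N.+1)%N /\ g r = peval p by exists f.
  move=> r; have [Ir|nI] := pselect (I r); last by exists 0 => /nI.
  by have [p [Hp gp]] := gN r Ir; exists p; split => //; apply/funext.
have PE r : I r -> P r = \sum_(a <- s) g r a *: ell a.
  move=> Ir; have [mP gP] := PP r Ir; apply: peval_inj => x.
  rewrite peval_sum; under eq_bigr do rewrite pevalZ mulrC.
  rewrite gP; apply: interp; exists (P r); split=> //.
  exact: leq_trans mP _.
have nI : \forall r \near t, I r by exact: open_nbhs_nbhs.
pose Q := \sum_(a <- s) 'D_1 (g^~ a) t *: ell a.
(* evaluation, evaluation of a space derivative, and coefficients are all
   linear functionals [phi] *)
have dP (phi : mpoly d R -> R) :
    (forall c : 'rV[R]_d -> R, phi (\sum_(a <- s) c a *: ell a) =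
      \sum_(a <- s) phi (ell a) * c a) ->
    is_derive t 1 (fun r => phi (P r)) (phi Q).
  move=> phiL; rewrite phiL.
  have dlin := is_derive_lincomb (phi \o ell)
    (fun a sa => derivableP (dg a sa)).
  apply: near_eq_is_derive dlin.
  by apply: filterS nI => r Ir; rewrite PE// phiL.
exists Q; split.
- apply/msize_leP => m' Nm'.
  have := dP (mcoeff m'); case=> [c|_ <-].
    by rewrite raddf_sum; apply: eq_bigr => a _; rewrite /= mcoeffZ mulrC.
  rewrite (near_eq_derive _ (g := cst 0)) ?derive_cst//.
  apply: filterS nI => r Ir; have [/msize_leP mP _] := PP r Ir.
  by rewrite mP.
- move=> x; apply: near_eq_is_derive (dP (fun p => peval p x) _).
    by apply: filterS nI => r Ir; have [_ ->] := PP r Ir.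
  by move=> c; rewrite peval_sum; apply: eq_bigr => a _; rewrite pevalZ mulrC.
- move=> j x; apply: near_eq_is_derive (dP (fun p => peval (mderiv j p) x) _).
    by apply: filterS nI => r Ir; have [_ ->] := PP r Ir; rewrite partial_peval.
  move=> c; rewrite raddf_sum peval_sum; apply: eq_bigr => a _ /=.
  by rewrite mderivZ pevalZ mulrC.
Qed.

End Unisolvence.

(** * The scheme holds pointwise *)

Lemma peval_div {R : realType} {d : nat} (P : 'I_d -> mpoly d R)
    (w : 'rV[R]_d -> 'rV[R]_d) x :
  (forall i y, w y 0 i = peval (P i) y) ->
  div w x = peval (\sum_i mderiv i (P i)) x.
Proof.
move=> wP; rewrite /div peval_sum; apply: eq_bigr => i _.
by rewrite -partial_peval; congr partial; apply/funext => y.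
Qed.

Section Scheme.
Context {R : realType} {d : nat} {Omega : set 'rV[R]_d}
  {T : simplicial_mesh Omega} {n N : nat} {S : cgdg_scheme T n N} {I : set R}
  {u : R -> broken T 'rV[R]_n} {ft : R -> broken T 'M[R]_(n, d)}.
Context (oI : open I) (sol : cgdg_solution S I u ft).

(** The residual [Q + F] has degree at most [N], so it may be used as the test
    function, which turns the weak equation into the vanishing of its square
    integral. *)
Lemma time_derivative_flux t k x i : I t ->
  is_derive t 1 (fun s => u s k x 0 i) (- div_tensor (ft t k) x 0 i).
Proof.
move=> It; have [uN du ftN weak] := sol.
have [s [ell [sk interp]]] := lagrange_basis k (nodes_lagrange S).
have [Q [QN dQ _]] : exists Q : mpoly d R, [/\ (msize Q <= N.+1)%N,
    forall x, is_derive t 1 (fun s => u s k x 0 i) (peval Q x) &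
    forall j x, is_derive t 1 (fun r => partial j (fun x => u r k x 0 i) x)
      (peval (mderiv j Q) x)].
  apply: (polynomial_time_derivative interp _ oI It) => //.
    by move=> r Ir; exact: uN.
  by move=> a /sk ka; exact: du.
have [P PN ftP] : exists2 P : 'I_d -> mpoly d R,
    forall j, (msize (P j) <= N.+2)%N & forall j y, ft t k y i j = peval (P j) y.
  suff /choice[f fP] : forall j, exists p : mpoly d R, (msize p <= N.+2)%N /\
      forall y, ft t k y i j = peval p y.
    by exists f => j; case: (fP j).
  move=> j; have [cg _] := ftN t It; have [dg _] := cg i j; exact: dg.
pose F := \sum_j mderiv j (P j).
have FE y : div_tensor (ft t k) y 0 i = peval F y.
  by rewrite mxE; apply: peval_div => j z; rewrite mxE.
have FN : (msize F <= N.+1)%N.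
  apply/msize_leP => m Nm; rewrite raddf_sum big1// => j _ /=.
  by have /msize_leP -> := msize_mderiv j (PN j).
have r0 : forall y, peval (Q + F) y = 0.
  apply: (simplex_integral_sqr_eq0 (v := vtx k)); first exact: mesh_nondegenerate.
  have := weak t It k (fun _ y => peval (Q + F) y) _ i.
  rewrite [X in X + _ = 0](_ : _ =
    integral_over (element k) (peval ((Q + F) * Q))); last first.
    apply: eq_Rintegral => z _; rewrite pevalM.
    by have [_ ->] := dQ (row_of_tuple z).
  rewrite [X in _ + X = 0](_ : _ =
    integral_over (element k) (peval ((Q + F) * F))); last first.
    by apply: eq_Rintegral => z _; rewrite pevalM FE.
  rewrite simplex_integralD; last exact: mesh_nondegenerate.
  rewrite -mulrDr; apply => l; exists (Q + F); split => //.
  apply/msize_leP => m Nm; rewrite mcoeffD.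
  by move/msize_leP: QN => ->//; move/msize_leP: FN => ->//; rewrite addr0.
rewrite FE; have -> : - peval F x = peval Q x.
  by apply/eqP; rewrite eq_sym -addr_eq0 -pevalD r0.
exact: dQ.
Qed.

Lemma linear_coord (L : {linear 'rV[R]_n -> 'rV[R]_d}) w i :
  L w 0 i = \sum_j L (delta_mx 0 j) 0 i * w 0 j.
Proof.
rewrite [in LHS](row_sum_delta w) linear_sum summxE.
by apply: eq_bigr => j _; rewrite linearZ mxE mulrC.
Qed.

(** The polynomial [W] is obtained as minus the time derivative of [L(u_h)], and
    not as an expression in the flux, because this also gives the exchange of the time
    derivative with the space derivatives of [L(u_h)]. *)
Lemma selected_field_evolution (L : {linear 'rV[R]_n -> 'rV[R]_d}) t k :
  I t -> exists W : 'I_d -> mpoly d R, [/\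
    forall x i, L (div_tensor (ft t k) x) 0 i = peval (W i) x,
    forall x i, is_derive t 1 (fun s => L (u s k x) 0 i) (- peval (W i) x) &
    forall x i j, is_derive t 1
      (fun s => partial j (fun y => L (u s k y) 0 i) x)
      (- peval (mderiv j (W i)) x)].
Proof.
move=> It; have [uN _ _ _] := sol.
have [s [ell [sk interp]]] := lagrange_basis k (nodes_lagrange S).
have dL x i : is_derive t 1 (fun s => L (u s k x) 0 i)
    (- L (div_tensor (ft t k) x) 0 i).
  rewrite (_ : (fun s => _) =
    fun s => \sum_j L (delta_mx 0 j) 0 i * u s k x 0 j); last first.
    by apply/funext => r; rewrite linear_coord.
  rewrite linear_coord -sumrN.
  under [X in is_derive _ _ _ X]eq_bigr do rewrite -mulrN.
  by apply: is_derive_lincomb => j _; exact: time_derivative_flux.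
suff /choice[W WP] : forall i, exists Wi : mpoly d R, [/\
    forall x, L (div_tensor (ft t k) x) 0 i = peval Wi x,
    forall x, is_derive t 1 (fun s => L (u s k x) 0 i) (- peval Wi x) &
    forall x j, is_derive t 1
      (fun s => partial j (fun y => L (u s k y) 0 i) x)
      (- peval (mderiv j Wi) x)].
  by exists W; split => x i; [|case: (WP i) => _ + _; exact|
    move=> j; case: (WP i) => _ _; exact]; case: (WP i).
move=> i.
have [Q [QN dQ dQj]] : exists Q : mpoly d R, [/\ (msize Q <= N.+1)%N,
    forall x, is_derive t 1 (fun s => L (u s k x) 0 i) (peval Q x) &
    forall j x, is_derive t 1 (fun r => partial j (fun x => L (u r k x) 0 i) x)
      (peval (mderiv j Q) x)].
  apply: (polynomial_time_derivative interp _ oI It) => //.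
  move=> r Ir.
  have /choice[P PP] j : exists p : mpoly d R, (msize p <= N.+1)%N /\
    forall y, u r k y 0 j = peval p y by have := uN r Ir 0 j k.
  exists (\sum_j L (delta_mx 0 j) 0 i *: P j); split.
    apply/msize_leP => m Nm; rewrite raddf_sum big1// => j _ /=.
    by have [/msize_leP PN _] := PP j; rewrite mcoeffZ PN ?mulr0.
  move=> y; rewrite linear_coord -/(peval _ y) peval_sum; apply: eq_bigr => j _.
  by have [_ ->] := PP j; rewrite pevalZ.
exists (- Q); split => x.
- by have [_ dl] := dL x i; have [_ dq] := dQ x; rewrite pevalN -dq dl opprK.
- by rewrite pevalN opprK.
- by move=> j; rewrite raddfN pevalN opprK.
Qed.

End Scheme.

(** * Tangents and normals of a face *)

Section Geometry.
Context {R : realType} {d : nat}.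

Lemma eq_on_interior (v : 'I_d.+1 -> 'rV[R]_d) (p q : mpoly d R) :
  affinely_independent v ->
  (forall x, interior (hull v [set: 'I_d.+1]%SET) x -> peval p x = peval q x) ->
  p = q.
Proof.
move=> nd pq; have [c Kc] := simplex_interior_nonempty nd.
apply/subr0_eq/peval_eq0/(@peval_eq0_nbhs R d _ c).
have : nbhs c (interior (hull v [set: 'I_d.+1]%SET)).
  by apply: open_nbhs_nbhs; split => //; exact: open_interior.
by apply: filterS => y /pq; rewrite pevalB => ->; rewrite subrr.
Qed.

Definition segment_closed (F : set 'rV[R]_d) :=
  forall a b (s : R), F a -> F b -> 0 <= s <= 1 -> F (a + s *: (b - a)).

Lemma hull_segment_closed m (v : 'I_m -> 'rV[R]_d) A : segment_closed (hull v A).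
Proof.
move=> _ _ s [a [a0 aA a1 ->]] [b [b0 bA b1 ->]] /andP[s0 s1].
exists (fun i => a i + s * (b i - a i)); split.
- move=> i; have -> : a i + s * (b i - a i) = (1 - s) * a i + s * b i by ring.
  by rewrite addr_ge0 ?mulr_ge0 ?subr_ge0.
- by move=> i iA; rewrite aA// bA// subrr mulr0 addr0.
- by rewrite big_split -mulr_sumr sumrB/= a1 b1 subrr mulr0 addr0.
- rewrite -sumrB scaler_sumr -big_split; apply: eq_bigr => i _ /=.
  by rewrite scalerDl -scalerA scalerBl.
Qed.

(** A tangential vector is a multiple of [a - b] with [a], [b] in [F], that is, of
    [(a - x) - (b - x)]; from [x] the function [h] is zero along the segments to
    [a] and to [b], which stay in [F]. *)
Lemma tangential_derivative_eq0 (F : set 'rV[R]_d) (h : mpoly d R) x tau :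
  segment_closed F -> (forall y, F y -> peval h y = 0) -> F x ->
  tangential F tau -> \sum_i tau 0 i * peval (mderiv i h) x = 0.
Proof.
move=> Fc h0 Fx [c [a [b [Fa Fb ->]]]].
have toward y : F y -> \sum_i (y - x) 0 i * peval (mderiv i h) x = 0.
  move=> Fy; have [q Hq] := line_restriction h x (y - x).
  have [_] := Hq 0; rewrite scale0r addr0 => <-.
  rewrite (poly_zero_interval (q := q) ltr01) ?deriv0 ?horner0// => s s01.
  by have [-> _] := Hq s; apply: h0; exact: Fc.
transitivity (c * (\sum_i (a - x) 0 i * peval (mderiv i h) x
                 - \sum_i (b - x) 0 i * peval (mderiv i h) x)).
  rewrite -sumrB mulr_sumr; apply: eq_bigr => i _; rewrite !mxE; ring.
by rewrite !toward// subrr mulr0.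
Qed.

Lemma dotC (a b : 'rV[R]_d) : dot a b = dot b a.
Proof. by apply: eq_bigr => i _; rewrite mulrC. Qed.

Lemma dotBr (a b c : 'rV[R]_d) : dot a (b - c) = dot a b - dot a c.
Proof. by rewrite -sumrB; apply: eq_bigr => i _; rewrite !mxE mulrBr. Qed.

Lemma dotBl (a b c : 'rV[R]_d) : dot (a - b) c = dot a c - dot b c.
Proof. by rewrite dotC dotBr !(dotC c). Qed.

Lemma dotZl s (a b : 'rV[R]_d) : dot (s *: a) b = s * dot a b.
Proof. by rewrite mulr_sumr; apply: eq_bigr => i _; rewrite mxE mulrA. Qed.

Lemma vertex_in_hull m (v : 'I_m -> 'rV[R]_d) (A : {set 'I_m}) i : i \in A ->
  hull v A (v i).
Proof.
move=> iA; exists (fun j => (j == i)%:R); split.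
- by move=> j; rewrite ler0n.
- by move=> j jA; case: eqP jA => [->|//]; rewrite iA.
- by rewrite (bigD1 i)//= eqxx big1 ?addr0// => j ji; rewrite (negbTE ji).
- rewrite (bigD1 i)//= eqxx scale1r big1 ?addr0// => j ji.
  by rewrite (negbTE ji) scale0r.
Qed.

Lemma orthogonal_to_edges (v : 'I_d.+1 -> 'rV[R]_d) z j :
  affinely_independent v ->
  (forall i, dot z (v i - v j) = 0) -> z = 0.
Proof.
rewrite /affinely_independent; set A := (\matrix_(i < d) _) => nd zv.
have Az : A *m z^T = 0.
  apply/matrixP => i c; rewrite ord1 !mxE.
  transitivity (dot z (v (lift ord0 i) - v j - (v ord0 - v j))).
    by apply: eq_bigr => a _; rewrite !mxE; ring.
  by rewrite dotBr !zv subrr.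
by apply: trmx_inj; rewrite trmx0 -[z^T](mulKmx nd) Az mulmx0.
Qed.

(** The cell k has a single vertex [p] off the face.  Subtract from [w] the
    multiple of [nu] with the same component along an edge [e] from the face to
    [p]: the difference is orthogonal to all edges of the cell, hence zero. *)
Lemma normal_direction (Omega : set 'rV[R]_d) (T : simplicial_mesh Omega)
    (k l : elt T) nu w :
  (0 < d)%N -> neighbours k l -> unit_normal (face k l) nu ->
  (forall tau, tangential (face k l) tau -> dot w tau = 0) ->
  exists c, w = c *: nu.
Proof.
move=> d0 kl [nu1 nuF] wF; set v := vtx k; set A := shared v (vtx l).
have cA : #|A| = d by apply/eqP.
have inF i : i \in A -> face k l (v i).
  move=> iA; split; first by apply: vertex_in_hull; rewrite finset.in_setT.
  have : v i \in codom (vtx l) by move: iA; rewrite inE.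
  by move=> /codomP[j ->]; apply: vertex_in_hull; rewrite finset.in_setT.
have edge i j : i \in A -> j \in A -> tangential (face k l) (v i - v j).
  move=> iA jA; exists 1, (v i), (v j); rewrite scale1r.
  by split => //; exact: inF.
have [j jA] : exists j, j \in A by apply/card_gt0P; rewrite cA.
have cAC : #|~: A| = 1%N.
  by apply: (@addnI d); rewrite -{1}cA cardsC card_ord addn1.
have [p pA] : exists p, ~: A = [set p]%SET by apply/cards1P/eqP.
have nA i : i \notin A -> i = p.
  by move=> iA; apply/eqP; rewrite -finset.in_set1 -pA inE.
pose e := v p - v j.
(* otherwise [nu] would be orthogonal to all edges of the cell as well *)
have nue : dot nu e != 0.
  apply: contra_eq_neq nu1 => nue0.
  have -> : nu = 0.
    apply: (@orthogonal_to_edges v _ j); first exact: mesh_nondegenerate.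
    move=> i; have [iA|/nA -> //] := boolP (i \in A).
    by apply: nuF; exact: edge.
  rewrite /dot big1 1?eq_sym ?oner_eq0// => i _.
  by rewrite mxE mul0r.
exists (dot w e / dot nu e); apply/subr0_eq.
apply: (@orthogonal_to_edges v _ j); first exact: mesh_nondegenerate.
move=> i; rewrite dotBl dotZl.
have [iA|/nA ->] := boolP (i \in A).
  have ij := edge _ _ iA jA.
  by rewrite (wF _ ij) (nuF _ ij) mulr0 subrr.
by rewrite divfK// subrr.
Qed.

End Geometry.

(** * Evolution of the selected vector field *)

Lemma is_derive_row {R : realType} {d : nat} (M : R -> 'rV[R]_d) (dM : 'rV[R]_d)
    (t : R) :
  (forall i, is_derive t 1 (fun s => M s 0 i) (dM 0 i)) -> is_derive t 1 M dM.
Proof.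
move=> MdM; have dv : derivable M t 1.
  by apply/derivable_mxP => i j; rewrite ord1; have [] := MdM j.
apply: DeriveDef => //; rewrite derive_mx//; apply/rowP => i; rewrite !mxE.
by have [_ <-] := MdM i.
Qed.

Section Involution.
Context {R : realType} {d : nat} {Omega : set 'rV[R]_d}
  {T : simplicial_mesh Omega}.

Lemma cg_space_polynomials m (G : broken T R) : cg_space m G ->
  exists g : elt T -> mpoly d R, (forall k x, G k x = peval (g k) x) /\
    forall k l x, face k l x -> peval (g k - g l) x = 0.
Proof.
move=> [dG [G0 [_ GG0]]].
have /choice[g gP] k : exists p : mpoly d R, forall x, G k x = peval p x.
  by have [p [_ pP]] := dG k; exists p.
exists g; split => // k l x [kx lx].
by rewrite pevalB -!gP (GG0 _ _ kx) (GG0 _ _ lx) subrr.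
Qed.

Lemma face_segment_closed (k l : elt T) : segment_closed (face k l).
Proof.
by move=> a b s [ka la] [kb lb] s01; split; exact: hull_segment_closed.
Qed.

(** The equation [d/dt v = - W].  The second clause does not follow from the
    first, since it also says that the time derivative commutes with the space
    derivatives. *)
Definition evolves_by (t : R) (v : R -> broken T 'rV[R]_d)
    (W : elt T -> 'I_d -> mpoly d R) :=
  (forall k x i, is_derive t 1 (fun s => v s k x 0 i) (- peval (W k i) x)) /\
  (forall k x i j, is_derive t 1 (fun s => partial j (fun y => v s k y 0 i) x)
      (- peval (mderiv j (W k i)) x)).

(** The hypothesis on [L(div f_h)] concerns interiors of cells only; both sides
    are polynomials, so it extends to the faces, where the jumps are taken. *)
Lemma scheme_evolves n N (S : cgdg_scheme T n N) (I : set R)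
    (u : R -> broken T 'rV[R]_n) (ft : R -> broken T 'M[R]_(n, d))
    (L : {linear 'rV[R]_n -> 'rV[R]_d}) t (W : elt T -> 'I_d -> mpoly d R) :
  open I -> cgdg_solution S I u ft -> I t ->
  (forall k x, interior (element k) x ->
    L (div_tensor (ft t k) x) = \row_i peval (W k i) x) ->
  evolves_by t (fun s k x => L (u s k x)) W.
Proof.
move=> oI sol It LW.
have evol k :
    (forall x i, is_derive t 1 (fun s => L (u s k x) 0 i) (- peval (W k i) x)) /\
    (forall x i j, is_derive t 1
      (fun s => partial j (fun y => L (u s k y) 0 i) x)
      (- peval (mderiv j (W k i)) x)).
  have [V [LV dV dVj]] := selected_field_evolution oI sol L k It.
  have VW i : V i = W k i.
    apply: (@eq_on_interior _ _ (vtx k)) => [|x kx].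
      exact: mesh_nondegenerate.
    by rewrite -LV LW// mxE.
  by split => x i; [rewrite -VW|move=> j; rewrite -VW].
by split => k x i; [|move=> j]; have [] := evol k.
Qed.

Lemma is_derive_jump t v W (k l : elt T) x (tau : 'rV[R]_d) : evolves_by t v W ->
  \sum_i tau 0 i * peval (W k i - W l i) x = 0 ->
  is_derive t 1 (fun s => jump k l (fun m y => dot (v s m y) tau) x) 0.
Proof.
move=> [dv _] W0; rewrite (_ : (fun s => _) =
    fun s => \sum_i tau 0 i * (v s k x 0 i - v s l x 0 i)); last first.
  apply/funext => s; rewrite /jump -sumrB.
  by apply: eq_bigr => i _; rewrite mulrBr mulrC [_ * tau 0 i]mulrC.
suff : is_derive t (1 : R)
    (fun s => \sum_i tau 0 i * (v s k x 0 i - v s l x 0 i))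
    (\sum_i tau 0 i * - peval (W k i - W l i) x).
  under [X in is_derive _ _ _ X]eq_bigr do rewrite mulrN.
  by rewrite sumrN W0 oppr0.
apply: is_derive_lincomb => i _.
rewrite pevalB opprB addrC -[peval (W l i) x]opprK.
by apply: is_deriveB; exact: dv.
Qed.

Lemma gradient_evolution n N m (S : cgdg_scheme T n N) (I : set R)
    (u : R -> broken T 'rV[R]_n) (ft : R -> broken T 'M[R]_(n, d))
    (L : {linear 'rV[R]_n -> 'rV[R]_d}) t (G : broken T R) :
  open I -> cgdg_solution S I u ft -> I t -> cg_space m G ->
  (forall k x, interior (element k) x ->
    L (div_tensor (ft t k) x) = grad (G k) x) ->
  exists g : elt T -> mpoly d R,
    (forall k l x, face k l x -> peval (g k - g l) x = 0) /\
    evolves_by t (fun s k x => L (u s k x)) (fun k i => mderiv i (g k)).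
Proof.
move=> oI sol It cG LG; have [g [gP g0]] := cg_space_polynomials cG.
exists g; split => //; apply: (scheme_evolves oI sol It).
move=> k x kx; rewrite LG//; apply/rowP => i; rewrite !mxE.
by rewrite -partial_peval; congr partial; apply/funext.
Qed.

Lemma gradient_tangential_jumps t v (g : elt T -> mpoly d R) :
  (forall k l x, face k l x -> peval (g k - g l) x = 0) ->
  evolves_by t v (fun k i => mderiv i (g k)) ->
  forall k l tau x, tangential (face k l) tau -> face k l x ->
    is_derive t 1 (fun s => jump k l (fun m y => dot (v s m y) tau) x) 0.
Proof.
move=> g0 ev k l tau x tF Fx; apply: is_derive_jump ev _.
transitivity (\sum_i tau 0 i * peval (mderiv i (g k - g l)) x).
  by apply: eq_bigr => i _; rewrite raddfB.
exact: tangential_derivative_eq0 (@face_segment_closed k l) (@g0 k l) Fx tF.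
Qed.

Lemma gradient_normal (k l : elt T) (h : mpoly d R) nu x :
  (0 < d)%N -> neighbours k l -> unit_normal (face k l) nu -> face k l x ->
  (forall y, face k l y -> peval h y = 0) ->
  exists c, forall i, peval (mderiv i h) x = c * nu 0 i.
Proof.
move=> d0 kl nuF Fx h0.
have [|c cP] := normal_direction (w := \row_i peval (mderiv i h) x) d0 kl nuF.
  move=> tau /(tangential_derivative_eq0 (@face_segment_closed k l) h0 Fx) <-.
  by rewrite dotC; apply: eq_bigr => i _; rewrite mxE.
by exists c => i; move/rowP/(_ i): cP; rewrite !mxE.
Qed.

End Involution.

(** * The vector calculus identities *)

Section ThreeD.
Context {R : realType} {Omega : set 'rV[R]_3} {T : simplicial_mesh Omega}.

Lemma curl_inside t (v : R -> broken T 'rV[R]_3) (g : elt T -> mpoly 3 R) k x :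
  evolves_by t v (fun k i => mderiv i (g k)) ->
  is_derive t 1 (fun s => curl (v s k) x) 0.
Proof.
move=> [_ dv]; apply: is_derive_row => i; rewrite mxE.
under eq_fun do rewrite mxE.
have := is_deriveB (dv k x (ordS (ordS i)) (ordS i))
  (dv k x (ordS i) (ordS (ordS i))).
by rewrite mderiv_comm subrr.
Qed.

Definition pcurl (G : 'I_3 -> mpoly 3 R) (i : 'I_3) : mpoly 3 R :=
  mderiv (ordS i) (G (ordS (ordS i))) - mderiv (ordS (ordS i)) (G (ordS i)).

Let e0 : 'I_3 := ord0.
Let e1 : 'I_3 := lift ord0 ord0.
Let e2 : 'I_3 := lift ord0 (lift ord0 ord0).

Let ordS0 : ordS e0 = e1. Proof. exact: val_inj. Qed.
Let ordS1 : ordS e1 = e2. Proof. exact: val_inj. Qed.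
Let ordS2 : ordS e2 = e0. Proof. exact: val_inj. Qed.

Lemma sum3 (V : zmodType) (F : 'I_3 -> V) : \sum_i F i = F e0 + F e1 + F e2.
Proof. by rewrite !big_ord_recl big_ord0 addr0 addrA. Qed.

Lemma div3_inside t (v : R -> broken T 'rV[R]_3)
    (g : elt T -> 'I_3 -> mpoly 3 R) k x :
  evolves_by t v (fun k => pcurl (g k)) ->
  is_derive t 1 (fun s => div (v s k) x) 0.
Proof.
move=> [_ dv]; rewrite /div; under eq_fun do rewrite sum3.
have := is_deriveD (is_deriveD (dv k x e0 e0) (dv k x e1 e1)) (dv k x e2 e2).
move=> /is_derive_eq; apply.
rewrite /pcurl ?(ordS0, ordS1, ordS2) !mderivB !pevalB.
rewrite (mderiv_comm e1 e0) (mderiv_comm e2 e0) (mderiv_comm e2 e1).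
ring.
Qed.

Lemma curl_normal_jumps t (v : R -> broken T 'rV[R]_3)
    (g : elt T -> 'I_3 -> mpoly 3 R) :
  (forall i k l x, face k l x -> peval (g k i - g l i) x = 0) ->
  evolves_by t v (fun k => pcurl (g k)) ->
  forall k l nu x, neighbours k l -> unit_normal (face k l) nu -> face k l x ->
    is_derive t 1 (fun s => jump k l (fun m y => dot (v s m y) nu) x) 0.
Proof.
move=> g0 ev k l nu x kl nuF Fx; apply: is_derive_jump ev _.
(* the gradient of the i-th component of the potential jumps by [c i] times [nu],
   so its curl jumps by a cross product with [nu] *)
have /choice[c cP] i := gradient_normal (isT : (0 < 3)%N) kl nuF Fx (@g0 i k l).
have E i : peval (pcurl (g k) i - pcurl (g l) i) x =
    c (ordS (ordS i)) * nu 0 (ordS i) - c (ordS i) * nu 0 (ordS (ordS i)).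
  by rewrite -!cP !mderivB !pevalB; ring.
by under eq_bigr do rewrite E; rewrite sum3 ?(ordS0, ordS1, ordS2); ring.
Qed.

End ThreeD.

Section TwoD.
Context {R : realType} {Omega : set 'rV[R]_2} {T : simplicial_mesh Omega}.

Lemma sum2 (V : zmodType) (F : 'I_2 -> V) : \sum_i F i = F 0 + F 1.
Proof.
rewrite !big_ord_recl big_ord0 addr0.
by congr (F _ + F _); exact: val_inj.
Qed.

Lemma scurl2_inside t (v : R -> broken T 'rV[R]_2) (g : elt T -> mpoly 2 R) k x :
  evolves_by t v (fun k i => mderiv i (g k)) ->
  is_derive t 1 (fun s => scurl2 (v s k) x) 0.
Proof.
move=> [_ dv]; have := is_deriveB (dv k x 1 0) (dv k x 0 1).
by rewrite mderiv_comm subrr.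
Qed.

Definition pvcurl2 (g : mpoly 2 R) (i : 'I_2) : mpoly 2 R :=
  if i == 0 then mderiv 1 g else - mderiv 0 g.

Lemma div2_inside t (v : R -> broken T 'rV[R]_2) (g : elt T -> mpoly 2 R) k x :
  evolves_by t v (fun k => pvcurl2 (g k)) ->
  is_derive t 1 (fun s => div (v s k) x) 0.
Proof.
move=> [_ dv]; rewrite /div; under eq_fun do rewrite sum2.
have := is_deriveD (dv k x 0 0) (dv k x 1 1).
move=> /is_derive_eq; apply.
by rewrite /pvcurl2 /= mderivN pevalN mderiv_comm opprK addNr.
Qed.

Lemma vcurl2_normal_jumps t (v : R -> broken T 'rV[R]_2)
    (g : elt T -> mpoly 2 R) :
  (forall k l x, face k l x -> peval (g k - g l) x = 0) ->
  evolves_by t v (fun k => pvcurl2 (g k)) ->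
  forall k l nu x, neighbours k l -> unit_normal (face k l) nu -> face k l x ->
    is_derive t 1 (fun s => jump k l (fun m y => dot (v s m y) nu) x) 0.
Proof.
move=> g0 ev k l nu x kl nuF Fx; apply: is_derive_jump ev _.
have [c cP] := gradient_normal (isT : (0 < 2)%N) kl nuF Fx (@g0 k l).
have c0 := cP 0; have c1 := cP 1.
rewrite !mderivB !pevalB in c0 c1.
rewrite sum2 /pvcurl2 /= !pevalB !pevalN.
transitivity (nu 0 0 * (peval (mderiv 1 (g k)) x - peval (mderiv 1 (g l)) x)
  - nu 0 1 * (peval (mderiv 0 (g k)) x - peval (mderiv 0 (g l)) x)); first ring.
by rewrite c0 c1; ring.
Qed.

End TwoD.

Unset Implicit Arguments.

Theorem proposition4 (R : realType) (n N : nat) :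
  (* curl involution, d = 3 *)
  [/\ forall (Omega : set 'rV[R]_3) (T : simplicial_mesh Omega)
        (S : cgdg_scheme T n N) (L : {linear 'rV[R]_n -> 'rV[R]_3})
        (I : set R) (u : R -> broken T 'rV[R]_n)
        (ft : R -> broken T 'M[R]_(n, 3)),
        flux_potential (@grad R 3) (flux S) L ->
        open I -> cgdg_solution S I u ft ->
        (forall t, I t -> exists G : broken T R, cg_space N.+1 G /\
           forall k x, interior (element k) x ->
             L (div_tensor (ft t k) x) = grad (G k) x) ->
        constant_inside (@curl R) I (fun t k x => L (u t k x)) /\
        constant_tangential_jumps I (fun t k x => L (u t k x)),
  (* curl involution, d = 2 *)
      forall (Omega : set 'rV[R]_2) (T : simplicial_mesh Omega)
        (S : cgdg_scheme T n N) (L : {linear 'rV[R]_n -> 'rV[R]_2})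
        (I : set R) (u : R -> broken T 'rV[R]_n)
        (ft : R -> broken T 'M[R]_(n, 2)),
        flux_potential (@grad R 2) (flux S) L ->
        open I -> cgdg_solution S I u ft ->
        (forall t, I t -> exists G : broken T R, cg_space N.+1 G /\
           forall k x, interior (element k) x ->
             L (div_tensor (ft t k) x) = grad (G k) x) ->
        constant_inside (@scurl2 R) I (fun t k x => L (u t k x)) /\
        constant_tangential_jumps I (fun t k x => L (u t k x)),
  (* divergence involution, d = 3 *)
      forall (Omega : set 'rV[R]_3) (T : simplicial_mesh Omega)
        (S : cgdg_scheme T n N) (L : {linear 'rV[R]_n -> 'rV[R]_3})
        (I : set R) (u : R -> broken T 'rV[R]_n)
        (ft : R -> broken T 'M[R]_(n, 3)),
        flux_potential (@curl R) (flux S) L ->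
        open I -> cgdg_solution S I u ft ->
        (forall t, I t -> exists G : broken T 'rV[R]_3,
           componentwise (cg_space N.+1) G /\
           forall k x, interior (element k) x ->
             L (div_tensor (ft t k) x) = curl (G k) x) ->
        constant_inside (@div R 3) I (fun t k x => L (u t k x)) /\
        constant_normal_jumps I (fun t k x => L (u t k x))
  (* divergence involution, d = 2 *)
    & forall (Omega : set 'rV[R]_2) (T : simplicial_mesh Omega)
        (S : cgdg_scheme T n N) (L : {linear 'rV[R]_n -> 'rV[R]_2})
        (I : set R) (u : R -> broken T 'rV[R]_n)
        (ft : R -> broken T 'M[R]_(n, 2)),
        flux_potential (@vcurl2 R) (flux S) L ->
        open I -> cgdg_solution S I u ft ->
        (forall t, I t -> exists G : broken T R, cg_space N.+1 G /\
           forall k x, interior (element k) x ->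
             L (div_tensor (ft t k) x) = vcurl2 (G k) x) ->
        constant_inside (@div R 2) I (fun t k x => L (u t k x)) /\
        constant_normal_jumps I (fun t k x => L (u t k x))].
Proof.
split=> Omega T S L I u ft _ oI sol pot.
- split=> t k.
    move=> x It _; have [G [cG LG]] := pot t It.
    have [g [_ evg]] := gradient_evolution oI sol It cG LG.
    exact: curl_inside evg.
  move=> l tau x It _ tF Fx; have [G [cG LG]] := pot t It.
  have [g [g0 evg]] := gradient_evolution oI sol It cG LG.
  exact (gradient_tangential_jumps g0 evg tF Fx).
- split=> t k.
    move=> x It _; have [G [cG LG]] := pot t It.
    have [g [_ evg]] := gradient_evolution oI sol It cG LG.
    exact: scurl2_inside evg.
  move=> l tau x It _ tF Fx; have [G [cG LG]] := pot t It.
  have [g [g0 evg]] := gradient_evolution oI sol It cG LG.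
  exact (gradient_tangential_jumps g0 evg tF Fx).
- have ev t : I t -> exists g : elt T -> 'I_3 -> mpoly 3 R,
      (forall i k l x, face k l x -> peval (g k i - g l i) x = 0) /\
      evolves_by t (fun s k x => L (u s k x)) (fun k => pcurl (g k)).
    move=> It; have [G [cG LG]] := pot t It.
    have /choice[g gP] i := cg_space_polynomials (cG 0 i).
    exists (fun k i => g i k); split; first by move=> i; case: (gP i).
    apply: (scheme_evolves oI sol It) => k x kx.
    rewrite LG//; apply/rowP => i; rewrite !mxE /pcurl pevalB -!partial_peval.
    have GE j : (fun y => G k y 0 j) = peval (g j k).
      by apply/funext => y; have [-> _] := gP j.
    by rewrite !GE.
  split=> t k.
    by move=> x /ev[g [_ evg]] _; exact: div3_inside evg.
  move=> l nu x /ev[g [g0 evg]] kl nF Fx.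
  exact (curl_normal_jumps g0 evg kl nF Fx).
- have ev t : I t -> exists g : elt T -> mpoly 2 R,
      (forall k l x, face k l x -> peval (g k - g l) x = 0) /\
      evolves_by t (fun s k x => L (u s k x)) (fun k => pvcurl2 (g k)).
    move=> It; have [G [cG LG]] := pot t It.
    have [g [gP g0]] := cg_space_polynomials cG.
    exists g; split => //.
    apply: (scheme_evolves oI sol It) => k x kx.
    rewrite LG//; apply/rowP => i; rewrite !mxE /pvcurl2.
    have -> : G k = peval (g k) by apply/funext.
    by case: ifP => _; rewrite ?pevalN partial_peval.
  split=> t k.
    by move=> x /ev[g [_ evg]] _; exact: div2_inside evg.
  move=> l nu x /ev[g [g0 evg]] kl nF Fx.
  exact (vcurl2_normal_jumps g0 evg kl nF Fx).
Qed.
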